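(* For all integers $n\geq 0$, $$a_{1^{1}2^{1}3^{-2}}(3n)>0,\qquad a_{1^{1}2^{1}3^{-2}}(3n+1)<0,\qquad a_{1^{1}2^{1}3^{-2}}(3n+2)<0.$$
   Context: For $|q|<1$ (or as formal power series in $q$) let $f_j:=(q^j;q^j)_\infty=\prod_{k\ge 1}(1-q^{jk})$ for each positive integer $j$. The integers $a_{1^{1}2^{1}3^{-2}}(n)$, $n\ge 0$, are defined by $\sum_{n=0}^\infty a_{1^{1}2^{1}3^{-2}}(n)q^n=\dfrac{f_1f_2}{f_3^2}$. *)

(* Defs.v *)
From mathcomp Require Import all_boot all_order all_algebra.
Set Implicit Arguments.
Unset Strict Implicit.
Unset Printing Implicit Defensive.
Import Order.TTheory GRing.Theory Num.Theory.
Local Open Scope ring_scope.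

(* A formal power series in q over int is its sequence of coefficients. *)
Definition fps := nat -> int.

Definition fps_mul (a b : fps) : fps :=
  fun n => \sum_(i < n.+1) a i * b (n - i)%N.

(* The first n coefficients of 1 / b, for b with constant coefficient 1:
   c_m = [m = 0] - \sum_(i < m) c_i b_(m - i). *)
Fixpoint fps_inv_seq (b : fps) (n : nat) : seq int :=
  if n is m.+1 then
    let s := fps_inv_seq b m in
    rcons s ((m == 0%N)%:R - \sum_(i < m) s`_i * b (m - i)%N)
  else [::].

(* Meaningful only when b 0 = 1; see fps_mulVr. *)
Definition fps_inv (b : fps) : fps := fun n => (fps_inv_seq b n.+1)`_n.

Definition fps_div (a b : fps) : fps := fps_mul a (fps_inv b).

(* f_j = (q^j; q^j)_oo for j > 0.  The factors 1 - q^(j k) with k > n do not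
   affect the coefficient of q^n; see eulerfE. *)
Definition eulerf (j : nat) : fps :=
  fun n => (\prod_(1 <= k < n.+1) (1 - 'X^(j * k)) : {poly int})`_n.

(* The coefficients a_{1^1 2^1 3^{-2}}(n) of f_1 f_2 / f_3^2. *)
Definition a_1_2_3m2 : fps :=
  fps_div (fps_mul (eulerf 1) (eulerf 2)) (fps_mul (eulerf 3) (eulerf 3)).

Lemma eulerfE (j n N : nat) : (0 < j)%N -> (n <= N)%N ->
  eulerf j n = (\prod_(1 <= k < N.+1) (1 - 'X^(j * k)) : {poly int})`_n.
Proof.
move=> j_gt0 /subnKC <-; elim: (N - n)%N => [|m ->]; first by rewrite addn0.
rewrite addnS [in RHS]big_nat_recr //= mulrBr mulr1 coefB coefMXn.
have -> : (n < j * (n + m).+1)%N.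
  by rewrite (leq_trans _ (leq_pmull _ j_gt0)) // ltnS leq_addr.
by rewrite subr0.
Qed.

Lemma size_fps_inv_seq (b : fps) (n : nat) : size (fps_inv_seq b n) = n.
Proof. by elim: n => //= n IHn; rewrite size_rcons IHn. Qed.

Lemma nth_fps_inv_seq (b : fps) (n i : nat) :
  (i < n)%N -> (fps_inv_seq b n)`_i = fps_inv b i.
Proof.
elim: n => // n IHn; rewrite ltnS leq_eqVlt => /orP[/eqP-> //|lt_in].
by rewrite /= nth_rcons size_fps_inv_seq lt_in IHn.
Qed.

Lemma fps_mulVr (b : fps) (n : nat) :
  b 0%N = 1 -> fps_mul (fps_inv b) b n = (n == 0%N)%:R.
Proof.
move=> b0; rewrite /fps_mul big_ord_recr /= subnn b0 mulr1.
have -> : fps_inv b n = (n == 0%N)%:R - \sum_(i < n) fps_inv b i * b (n - i)%N.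
  rewrite {1}/fps_inv /= nth_rcons size_fps_inv_seq ltnn eqxx.
  by congr (_ - _); apply: eq_bigr => i _; rewrite nth_fps_inv_seq.
by rewrite addrC subrK.
Qed.

Lemma eulerf_sqr0 (j : nat) : fps_mul (eulerf j) (eulerf j) 0%N = 1.
Proof. by rewrite /fps_mul big_ord1 /eulerf big_geq // coef1. Qed.

(* Main.v *)
Require Import Defs.
From mathcomp Require Import all_boot all_order all_algebra.
From mathcomp Require Import zify ring.
Import Order.TTheory GRing.Theory Num.Theory.
Local Open Scope ring_scope.

(* Write f_j = (q^j; q^j)_oo.  Then 2 f_1 f_2 = phi(-q) * 2 psi(q), where, in
   terms of Ramanujan's f(a, b) = sum_n a^(n(n+1)/2) b^(n(n-1)/2),
   phi(-q) = f(-q, -q) and 2 psi(q) = f(1, q).  Splitting both sums by n mod 3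
   and applying the Jacobi triple product to each piece gives, with x = q^3,
   f_1 f_2 = (phi(-x^3) - 2 q f(-x, -x^5)) (f(x, x^2) + q psi(x^3)), so that
     f_1 f_2 / f_3^2 = P0(x) - q P1(x) - 2 q^2 P2(x).
   P1 and P2 are products of factors 1 + x^m and 1 / (1 - x^m).  P0 also has
   the factors 1 - x^(6k+3), each of which is absorbed by
   1 / ((1 - x^(3k+1)) (1 - x^(3k+2))).  All three keep a factor 1 / (1 - x),
   so all their coefficients are positive.

   Infinite products and theta series are finite here, because the identities
   are proved in a commutative ring where q ^+ N = 0; the coefficients below N
   are then read off in Z[X] / (X^N). *)

(** * Gaussian binomials and the finite Jacobi triple product *)

Section JacobiTripleProduct.
Context {R : comNzRingType}.
Implicit Types (a b p : R) (i j k m n L M N : nat).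

(* [gauss p i j] is the Gaussian binomial coefficient [i + j choose i]_p. *)
Fixpoint gauss p i : nat -> R :=
  if i is i'.+1 then
    fix row j := if j is j'.+1 then gauss p i' j + p ^+ i * row j' else 1
  else fun=> 1.

Lemma gauss0 p i : gauss p i 0 = 1.
Proof. by case: i. Qed.

Lemma gaussSS p i j :
  gauss p i.+1 j.+1 = gauss p i j.+1 + p ^+ i.+1 * gauss p i.+1 j.
Proof. by []. Qed.

(** The other q-Pascal rule. In [finite_jacobi] it absorbs a new factor of the product in [a], and
    [gaussSS] one of the product in [b]. *)
Lemma gaussSS_sym p i j :
  gauss p i.+1 j.+1 = p ^+ j.+1 * gauss p i j.+1 + gauss p i.+1 j.
Proof.
elim: i j => [|i IHi] j.
  elim: j => [|j IHj]; first by rewrite gaussSS !gauss0 /=; ring.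
  by rewrite gaussSS {1}IHj gaussSS /= !exprS; ring.
elim: j => [|j IHj].
  by rewrite gaussSS {1}IHi gaussSS !gauss0 !exprS; ring.
rewrite gaussSS {1}IHi {1}IHj.
rewrite [gauss p i.+1 j.+2]gaussSS [gauss p i.+2 j.+1]gaussSS !exprS; ring.
Qed.

Definition qpoch p n : R := \prod_(i < n) (1 - p ^+ i.+1).

Lemma qpochS p n : qpoch p n.+1 = qpoch p n * (1 - p ^+ n.+1).
Proof. exact: big_ord_recr. Qed.

(** Stated without division, since [qpoch p n] need not be invertible in [R]. *)
Lemma gauss_qpoch p i j :
  gauss p i j * (qpoch p i * qpoch p j) = qpoch p (i + j).
Proof.
elim: i j => [|i IHi] j; first by rewrite /= /qpoch big_ord0 !mul1r.
elim: j => [|j IHj].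
  by rewrite gauss0 addn0 /qpoch big_ord0 mulr1 mul1r.
have e1 := IHi j.+1.
rewrite addSnnS in IHj; rewrite gaussSS addSn [RHS]qpochS.
(* The two summands match the two terms of [gaussSS]. *)
have -> : (1 - p ^+ (i + j.+1).+1) =
          (1 - p ^+ i.+1) + p ^+ i.+1 * (1 - p ^+ j.+1).
  by rewrite -addSn exprD; ring.
rewrite [RHS]mulrDr -{1}e1 mulrCA -IHj !qpochS; ring.
Qed.

Lemma bin2S n : 'C(n.+1, 2) = ('C(n, 2) + n)%N.
Proof. by rewrite binS bin1. Qed.

(* The term a^(n(n+1)/2) b^(n(n-1)/2) of Ramanujan's theta series f(a, b), for
   the possibly negative index n = k - N; one of the two truncated
   differences below is zero. *)
Definition theta_term a b N k : R :=
  a ^+ ('C((k - N).+1, 2) + 'C(N - k, 2)) *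
  b ^+ ('C(k - N, 2) + 'C((N - k).+1, 2)).

Lemma theta_termSS a b N k : theta_term a b N.+1 k.+1 = theta_term a b N k.
Proof. by rewrite /theta_term !subSS. Qed.

(** With n = k - N, the terms of index n + 1 and n have ratio a (a b)^n; the powers of [a * b] on
    both sides keep all exponents natural. *)
Lemma theta_term_up a b M N k : (k <= M + N)%N ->
  a * (a * b) ^+ M * theta_term a b N k =
  (a * b) ^+ (M + N - k) * theta_term a b N k.+1.
Proof.
rewrite /theta_term => kMN; have [Nk|kN] := leqP N k.
  have -> : (N - k = 0)%N by lia.
  have -> : (N - k.+1 = 0)%N by lia.
  rewrite subSn // !bin2S /= ?bin0n !addn0.
  have {1}-> : (M = (M + N - k) + (k - N))%N by lia.
  by rewrite !exprMn !exprD !exprS; ring.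
have -> : (k - N = 0)%N by lia.
have -> : (k.+1 - N = 0)%N by lia.
have -> : (N - k = (N - k.+1).+1)%N by lia.
have -> : (M + N - k = M + (N - k.+1).+1)%N by lia.
rewrite !bin2S /= ?bin0n !add0n.
by rewrite !exprMn !exprD !exprS; ring.
Qed.

Lemma theta_term_down a b N k :
  b * (a * b) ^+ N * theta_term a b N k =
  (a * b) ^+ k * theta_term a b N.+1 k.
Proof.
rewrite /theta_term; have [Nk|kN] := leqP N.+1 k.
  have -> : (N - k = 0)%N by lia.
  have -> : (N.+1 - k = 0)%N by lia.
  have -> : (k - N = (k - N.+1).+1)%N by lia.
  have {3 4}-> : k = (N + (k - N.+1).+1)%N by lia.
  have -> : (N + (k - N.+1).+1 - N.+1 = k - N.+1)%N by lia.
  rewrite !bin2S /= ?bin0n !addn0.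
  by rewrite !exprMn !exprD !exprS; ring.
have -> : (k - N = 0)%N by lia.
have -> : (k - N.+1 = 0)%N by lia.
rewrite subSn //.
have {1}-> : N = (k + (N - k))%N by lia.
rewrite !bin2S /= ?bin0n !add0n.
by rewrite !exprMn !exprD !exprS; ring.
Qed.

(** Regroups a sum multiplied by a two-term factor according to the [u k]; the relation between [A],
    [B] and [C] is then a q-Pascal rule. *)
Lemma sum_shift m (A B C u : nat -> R) :
  C 0%N = A 0%N -> C m.+1 = B m ->
  (forall k, (k < m)%N -> C k.+1 = A k.+1 + B k) ->
  \sum_(k < m.+1) (A k * u k + B k * u k.+1) = \sum_(k < m.+2) C k * u k.
Proof.
move=> C0 Cm CS; have e : \sum_(k < m) C k.+1 * u k.+1 =
         \sum_(k < m) A k.+1 * u k.+1 + \sum_(k < m) B k * u k.+1.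
  by rewrite -big_split; apply: eq_bigr => k _; rewrite CS // mulrDl.
rewrite big_split /= big_ord_recl [X in _ + X]big_ord_recr.
rewrite [RHS]big_ord_recl [X in _ = _ + X]big_ord_recr /=.
by rewrite -[\sum_(i < m) C _ * _]/(\sum_(i < m) C i.+1 * u i.+1)
  e C0 Cm !addrA.
Qed.

(** One more factor adds a copy of the sum with its index shifted by one, and a q-Pascal rule merges
    the two copies. *)
Lemma finite_jacobi a b M N (p := a * b) :
  \prod_(i < M) (1 + a * p ^+ i) * \prod_(i < N) (1 + b * p ^+ i) =
  \sum_(k < (M + N).+1) gauss p k (M + N - k) * theta_term a b N k.
Proof.
elim: N => [|N IHN].
  rewrite big_ord0 mulr1 addn0.
  elim: M => [|M IHM].
    rewrite big_ord0 big_ord1 /theta_term /= !subn0; ring.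
  rewrite big_ord_recr /= IHM mulr_suml.
  pose C k := gauss p k (M.+1 - k).
  pose A k := gauss p k (M - k).
  pose B k := gauss p k (M - k) * p ^+ (M - k).
  rewrite -(@sum_shift M A B C); first last.
  - move=> k kM; rewrite /C /A /B subSS.
    have -> : (M - k = (M - k.+1).+1)%N by lia.
    by rewrite gaussSS_sym; ring.
  - by rewrite /C /B !subnn !gauss0 expr0 mulr1.
  - by [].
  apply: eq_bigr => k _; rewrite /A /B -[X in _ = _ + X]mulrA.
  have kM : (k <= M + 0)%N by rewrite addn0 -ltnS.
  have := @theta_term_up a b M 0 k kM; rewrite addn0 -/p => <-; ring.
rewrite big_ord_recr /= mulrA IHN mulr_suml addnS.
pose C k := gauss p k ((M + N).+1 - k).
pose A k := gauss p k (M + N - k) * p ^+ k.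
pose B k := gauss p k (M + N - k).
rewrite -(@sum_shift (M + N) A B C); first last.
- move=> k kM; rewrite /C /A /B subSS.
  have -> : (M + N - k = (M + N - k.+1).+1)%N by lia.
  by rewrite gaussSS; ring.
- by rewrite /C /B !subnn !gauss0.
- by rewrite /C /A expr0 mulr1.
(* The centre moves from N to N + 1, so the old term k becomes term k + 1 and the factor
   [b * p ^+ N] produces term k. *)
apply: eq_bigr => k _; rewrite /A /B theta_termSS -[X in _ = X + _]mulrA.
have := @theta_term_down a b N k; rewrite -/p => <-; ring.
Qed.

(** f(a, b) cut off symmetrically, to the indices from -L to L. *)
Definition theta L a b : R := \sum_(k < (L + L).+1) theta_term a b L k.

End JacobiTripleProduct.

(** * Theta series with [a * b] nilpotent: triple product and 3-dissection *)

Lemma big_residues (T : Type) (idx : T) (op : Monoid.com_law idx) (m n : nat)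
    (F : nat -> T) :
  \big[op/idx]_(k < m * n) F k =
  \big[op/idx]_(j < m) \big[op/idx]_(k < n) F (m * k + j)%N.
Proof.
elim: n => [|n IHn].
  by rewrite muln0 big_ord0 big1 // => j _; rewrite big_ord0.
rewrite mulnSr big_split_ord IHn /=.
by under [RHS]eq_bigr do rewrite big_ord_recr; rewrite big_split.
Qed.

Section Nilpotent.
Context {R : comNzRingType}.
Implicit Types (a b p x y : R) (i j k m n l L M N : nat).

Lemma nilp_expr_geq {x N} n : x ^+ N = 0 -> (N <= n)%N -> x ^+ n = 0.
Proof. by move=> x0 /subnKC <-; rewrite exprD x0 mul0r. Qed.

Lemma nilp_exprX {x N} n : x ^+ N = 0 -> (0 < n)%N -> (x ^+ n) ^+ N = 0.
Proof.
by move=> x0 n0; rewrite -exprM; apply: nilp_expr_geq x0 _; rewrite leq_pmull.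
Qed.

Definition geom N x : R := \sum_(i < N) x ^+ i.

Lemma geomE N x : x ^+ N = 0 -> (1 - x) * geom N x = 1.
Proof. by move=> x0; rewrite -opprB mulNr -subrX1 x0 sub0r opprK. Qed.

Lemma mul_unit_inj u v x y : u * v = 1 :> R -> u * x = u * y -> x = y.
Proof.
by move=> uv e; rewrite -[x]mul1r -[y]mul1r -uv ![u * v]mulrC -!mulrA e.
Qed.

Lemma prod_trim N M (F : nat -> R) :
  (forall i, (N <= i)%N -> F i = 1) -> (N <= M)%N ->
  \prod_(i < M) F i = \prod_(i < N) F i.
Proof.
move=> F1 /subnKC <-; rewrite big_split_ord /= [X in _ * X]big1 ?mulr1 //.
by move=> i _; rewrite F1 // leq_addr.
Qed.

(** Here |k - L| > N, so both exponents are at least N, because C(m, 2) >= N for m > N; hence (a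
    b)^N divides the term. *)
Lemma theta_term_eq0 a b N L k : (a * b) ^+ N = 0 ->
  (k + N < L)%N || (L + N < k)%N -> theta_term a b L k = 0.
Proof.
move=> ab0 far.
have big m : (N < m)%N -> (N <= 'C(m, 2))%N.
  by move=> Nm; apply: leq_trans (leq_bin2l 2 Nm); rewrite bin2S leq_addl.
suff [s [t e]] : exists s t, theta_term a b L k = a ^+ (N + s) * b ^+ (N + t).
  by rewrite e !exprD mulrACA -exprMn ab0 mul0r.
rewrite /theta_term.
set A := addn _ _; set B := addn _ _; exists (A - N)%N, (B - N)%N.
suff [NA NB] : (N <= A)%N /\ (N <= B)%N by rewrite !subnKC.
case/orP: far => far; split.
- by apply: leq_trans (leq_addl _ _); apply: big; lia.
- by apply: leq_trans (leq_addl _ _); apply: big; lia.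
- by apply: leq_trans (leq_addr _ _); apply: big; lia.
- by apply: leq_trans (leq_addr _ _); apply: big; lia.
Qed.

(** In [finite_jacobi] with both lengths L, the terms with |k - L| > N vanish. For the others k and
    2 L - k are at least N, as L > 2 N, and the Gaussian binomial is the inverse of [qpoch p N]. *)
Lemma jacobi_triple a b N L (p := a * b) : p ^+ N = 0 -> (N.*2 < L)%N ->
  theta L a b = \prod_(i < N) (1 + a * p ^+ i) *
                \prod_(i < N) (1 + b * p ^+ i) * \prod_(i < N) (1 - p ^+ i.+1).
Proof.
move=> p0 NL.
have trim x : \prod_(i < N) (1 + x * p ^+ i) = \prod_(i < L) (1 + x * p ^+ i).
  symmetry; apply: (prod_trim N L (fun i => 1 + x * p ^+ i)); last by lia.
  by move=> i Ni; rewrite (nilp_expr_geq i p0 Ni) mulr0 addr0.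
have trimQ n : (N <= n)%N -> qpoch p n = qpoch p N.
  apply: (prod_trim N n (fun i => 1 - p ^+ i.+1)) => i Ni.
  by rewrite (nilp_expr_geq i.+1 p0) ?subr0 // leqW.
have invQ : qpoch p N * \prod_(i < N) geom N (p ^+ i.+1) = 1.
  by rewrite -big_split /= big1 // => i _; rewrite geomE // nilp_exprX.
rewrite !trim -/(qpoch p N) finite_jacobi mulr_suml.
apply: eq_bigr => k _.
have [far|near] := boolP ((k + N < L)%N || (L + N < k)%N).
  by rewrite (theta_term_eq0 _ _ _ _ _ p0 far) mulr0 mul0r.
suff gQ : gauss p k (L + L - k) * qpoch p N = 1.
  by rewrite mulrAC gQ mul1r.
have := gauss_qpoch p k (L + L - k).
rewrite !trimQ; try lia; move=> e.
by apply: (mul_unit_inj _ _ _ _ invQ); rewrite mulr1 -[RHS]e; ring.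
Qed.

Lemma bin2_triple n : 'C(3 * n, 2) = (9 * 'C(n, 2) + 3 * n)%N.
Proof. by elim: n => // n IHn; rewrite mulnS add3n !bin2S IHn; lia. Qed.

Lemma theta_termX a b s t s' t' l j :
  theta_term (a ^+ s * b ^+ t) (a ^+ s' * b ^+ t') l j =
  a ^+ (s * ('C((j - l).+1, 2) + 'C(l - j, 2)) +
        s' * ('C(j - l, 2) + 'C((l - j).+1, 2))) *
  b ^+ (t * ('C((j - l).+1, 2) + 'C(l - j, 2)) +
        t' * ('C(j - l, 2) + 'C((l - j).+1, 2))).
Proof. by rewrite /theta_term !exprMn -!exprM mulrACA -!exprD. Qed.

(** The centre 3 l + 1 gives k = 3 j, 3 j + 1, 3 j + 2 the indices 3 n - 1, 3 n, 3 n + 1, where n =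
    j - l. *)
Lemma theta_term_mid a b l j :
  theta_term a b (3 * l).+1 (3 * j).+1 =
  theta_term (a ^+ 6 * b ^+ 3) (a ^+ 3 * b ^+ 6) l j.
Proof.
rewrite theta_termX /theta_term !subSS -!mulnBr !bin2S !bin2_triple.
by congr (_ ^+ _ * _ ^+ _); lia.
Qed.

Lemma theta_term_right a b l j :
  theta_term a b (3 * l).+1 (3 * j).+2 =
  a * theta_term (a ^+ 9 * b ^+ 6) (a ^+ 0 * b ^+ 3) l j.
Proof.
rewrite theta_termX mulrA -exprS /theta_term !subSS.
have [lj|jl] := leqP l j.
  rewrite subSn ?leq_mul // -mulnBr.
  have -> : (3 * l - (3 * j).+1 = 0)%N by lia.
  have -> : (l - j = 0)%N by lia.
  rewrite !bin2S !bin2_triple ?bin0n.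
  by congr (_ ^+ _ * _ ^+ _); lia.
have -> : ((3 * j).+1 - 3 * l = 0)%N by lia.
have -> : (j - l = 0)%N by lia.
have -> : (3 * l - (3 * j).+1 = (3 * (l - j.+1)).+2)%N by lia.
have -> : (l - j = (l - j.+1).+1)%N by lia.
rewrite !bin2S !bin2_triple ?bin0n.
by congr (_ ^+ _ * _ ^+ _); lia.
Qed.

Lemma theta_term_left a b l j :
  theta_term a b (3 * l).+1 (3 * j) =
  b * theta_term (a ^+ 3 * b ^+ 0) (a ^+ 6 * b ^+ 9) l j.
Proof.
rewrite theta_termX mulrCA -exprS /theta_term.
have [jl|lj] := leqP j l.
  rewrite subSn ?leq_mul // -mulnBr.
  have -> : (3 * j - (3 * l).+1 = 0)%N by lia.
  have -> : (j - l = 0)%N by lia.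
  rewrite !bin2S !bin2_triple ?bin0n.
  by congr (_ ^+ _ * _ ^+ _); lia.
have -> : ((3 * l).+1 - 3 * j = 0)%N by lia.
have -> : (l - j = 0)%N by lia.
have -> : (3 * j - (3 * l).+1 = (3 * (j - l.+1)).+2)%N by lia.
have -> : (j - l = (j - l.+1).+1)%N by lia.
rewrite !bin2S !bin2_triple ?bin0n.
by congr (_ ^+ _ * _ ^+ _); lia.
Qed.

(** There are 2 (3 l + 1) + 1 = 3 (2 l + 1) terms, so each residue class of k modulo 3 is a complete
    series [theta l]. *)
Lemma theta_3dissection l a b :
  theta (3 * l).+1 a b =
    theta l (a ^+ 6 * b ^+ 3) (a ^+ 3 * b ^+ 6) +
    a * theta l (a ^+ 9 * b ^+ 6) (a ^+ 0 * b ^+ 3) +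
    b * theta l (a ^+ 3 * b ^+ 0) (a ^+ 6 * b ^+ 9).
Proof.
rewrite /theta.
have -> : ((3 * l).+1 + (3 * l).+1).+1 = (3 * (l + l).+1)%N by lia.
rewrite (big_residues _ _ _ 3 _ (theta_term a b (3 * l).+1)).
rewrite 3!big_ord_recr big_ord0 /= !mulr_sumr.
under [X in 0 + X]eq_bigr do rewrite addn0 theta_term_left.
under [X in 0 + _ + X]eq_bigr do rewrite addn1 theta_term_mid.
under [X in _ + X = _]eq_bigr do rewrite addn2 theta_term_right.
by ring.
Qed.
End Nilpotent.

(** * Infinite products in a nilpotent variable *)

Section Products.
Context {R : comNzRingType}.
Implicit Types (x q : R) (c r s k L N : nat).

(** For [x ^+ N = 0] and positive [c], [r], these three are (x^r; x^c)_oo, (-x^r; x^c)_oo and 1 /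
    (x^r; x^c)_oo. *)
Definition qminus N x c r : R := \prod_(k < N) (1 - x ^+ (c * k + r)).
Definition qplus N x c r : R := \prod_(k < N) (1 + x ^+ (c * k + r)).
Definition qinv N x c r : R := \prod_(k < N) geom N (x ^+ (c * k + r)).

Lemma qminusV N x c r : x ^+ N = 0 -> (0 < r)%N ->
  qminus N x c r * qinv N x c r = 1.
Proof.
move=> x0 r0; rewrite -big_split /= big1 // => k _.
by rewrite geomE // nilp_exprX // addn_gt0 r0 orbT.
Qed.

Lemma qplus_minus N x c r :
  qplus N x c r * qminus N x c r = qminus N x (2 * c) (2 * r).
Proof.
rewrite -big_split; apply: eq_bigr => k _ /=.
have -> : (2 * c * k + 2 * r = (c * k + r) * 2)%N by lia.
by rewrite exprM; ring.
Qed.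

Lemma qminus_trim N M x c r : x ^+ N = 0 -> (0 < c)%N -> (N <= M)%N ->
  qminus M x c r = qminus N x c r.
Proof.
move=> x0 c0; apply: (prod_trim N M (fun k => 1 - x ^+ (c * k + r))) => k Nk.
rewrite (nilp_expr_geq _ x0) ?subr0 //.
by apply: leq_trans Nk _; apply: leq_trans (leq_addr _ _); rewrite leq_pmull.
Qed.

Lemma qminus_split N x m c r : x ^+ N = 0 -> (0 < m)%N -> (0 < c)%N ->
  qminus N x c r = \prod_(j < m) qminus N x (m * c) (c * j + r).
Proof.
move=> x0 m0 c0; rewrite -(qminus_trim N (m * N)) // ?leq_pmull //.
rewrite /qminus (big_residues _ _ _ _ _ (fun k => 1 - x ^+ (c * k + r))).
apply: eq_bigr => j _; apply: eq_bigr => k _.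
by congr (1 - x ^+ _); lia.
Qed.

Lemma theta_minus N L x r s : x ^+ N = 0 -> (0 < r + s)%N -> (N.*2 < L)%N ->
  theta L (- x ^+ r) (- x ^+ s) =
  qminus N x (r + s) r * qminus N x (r + s) s * qminus N x (r + s) (r + s).
Proof.
move=> x0 rs NL.
have p0 : (- x ^+ r * - x ^+ s) ^+ N = 0.
  by rewrite mulrNN -exprD nilp_exprX.
rewrite (jacobi_triple _ _ _ _ p0 NL) mulrNN -exprD.
by congr (_ * _ * _); apply: eq_bigr => k _; rewrite -exprM ?mulNr -?exprD;
  congr (1 - x ^+ _); lia.
Qed.

Lemma theta_plus N L x r s : x ^+ N = 0 -> (0 < r + s)%N -> (N.*2 < L)%N ->
  theta L (x ^+ r) (x ^+ s) =
  qplus N x (r + s) r * qplus N x (r + s) s * qminus N x (r + s) (r + s).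
Proof.
move=> x0 rs NL.
have p0 : (x ^+ r * x ^+ s) ^+ N = 0 by rewrite -exprD nilp_exprX.
rewrite (jacobi_triple _ _ _ _ p0 NL) -exprD.
by congr (_ * _ * _); apply: eq_bigr => k _; rewrite -exprM -?exprD;
  congr (_ + _ ); try congr (- _); congr (x ^+ _); lia.
Qed.

(** The factor k = 0 on the left is 1 + 1, and the last factor of [qplus N x c c] is 1. *)
Lemma qplus0 N x c : x ^+ N = 0 -> (0 < N)%N -> (0 < c)%N ->
  qplus N x c 0 = 2 * qplus N x c c.
Proof.
case: N => // N x0 _ c0; have F1 k : (N <= k)%N -> 1 + x ^+ (c * k + c) = 1.
  move=> Nk; rewrite -mulnSr (nilp_expr_geq _ x0) ?addr0 //.
  by apply: (@leq_trans k.+1); rewrite // leq_pmull.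
rewrite /qplus (prod_trim N N.+1 _ F1 (leqnSn N)) big_ord_recl muln0 expr0.
congr (_ * _).
by apply: eq_bigr => k _; rewrite addn0 lift0 mulnSr.
Qed.

(** Euler's identity between odd and distinct parts, obtained by cancelling (x^(2c); x^(2c))_oo. *)
Lemma qplus_odd N x c : x ^+ N = 0 -> (0 < c)%N ->
  qminus N x (2 * c) c * qplus N x c c = 1.
Proof.
move=> x0 c0; have c20 : (0 < 2 * c)%N by rewrite muln_gt0.
apply: (mul_unit_inj _ _ _ _ (qminusV N x (2 * c) _ x0 c20)).
have := qminus_split N x 2 c c x0 isT c0.
rewrite !big_ord_recr big_ord0 /= mul1r muln0 muln1 add0n addnn -mul2n => e.
by rewrite mulr1 -[RHS]qplus_minus e; ring.
Qed.

Lemma theta_phi N L x c : x ^+ N = 0 -> (0 < c)%N -> (N.*2 < L)%N ->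
  theta L (- x ^+ c) (- x ^+ c) = qminus N x (2 * c) c * qminus N x c c.
Proof.
move=> x0 c0 NL; rewrite (theta_minus N) ?addn_gt0 ?c0 // addnn -mul2n.
rewrite (qminus_split N x 2 c c x0 isT c0).
by rewrite !big_ord_recr big_ord0 /= mul1r muln0 muln1 add0n addnn -mul2n mulrA.
Qed.

Lemma theta_psi N L x c : x ^+ N = 0 -> (0 < N)%N -> (0 < c)%N ->
  (N.*2 < L)%N ->
  theta L 1 (x ^+ c) = 2 * qplus N x c c ^+ 2 * qminus N x c c.
Proof.
move=> x0 N0 c0 NL; rewrite -(expr0 x) (theta_plus N) ?add0n // qplus0 //.
by ring.
Qed.

End Products.

(** * The 3-dissections of f_1 f_2 and of f_1 f_2 / f_3^2 *)

Section Dissection.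
Context {R : comNzRingType}.
Implicit Types (x q A : R) (k N : nat).

(** Multiply (-x; x^3) (x; x^3) = (x^2; x^6) by (-x^2; x^3) (x^2; x^3) = (x^4; x^6), split the
    factors without sign modulo 6, and cancel (x^2; x^6) (x^4; x^6). *)
Lemma qplus_qminus_mod6 N x : x ^+ N = 0 ->
  qplus N x 3 1 * qplus N x 3 2 * (qminus N x 6 1 * qminus N x 6 5) = 1.
Proof.
move=> x0.
have V2 := qminusV N x 6 2 x0 isT; have V4 := qminusV N x 6 4 x0 isT.
have V : qminus N x 6 2 * qminus N x 6 4 *
         (qinv N x 6 2 * qinv N x 6 4) = 1.
  by rewrite mulrACA V2 V4 mulr1.
apply: (mul_unit_inj _ _ _ _ V); rewrite mulr1.
have e1 : qplus N x 3 1 * (qminus N x 6 1 * qminus N x 6 4) = qminus N x 6 2.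
  rewrite -[RHS](qplus_minus N x 3 1) (qminus_split N x 2 3 1 x0) //.
  by rewrite !big_ord_recr big_ord0 /= mul1r.
have e2 : qplus N x 3 2 * (qminus N x 6 2 * qminus N x 6 5) = qminus N x 6 4.
  rewrite -[RHS](qplus_minus N x 3 2) (qminus_split N x 2 3 2 x0) //.
  by rewrite !big_ord_recr big_ord0 /= mul1r.
by apply: etrans (congr2 *%R e1 e2); ring.
Qed.

(** The factor 2 of 2 psi(q) stays, since 2 may be a zero divisor in [R]. *)
Lemma f1_f2_dissection N q (x := q ^+ 3) : q ^+ N = 0 -> (0 < N)%N ->
  2 * (qminus N q 1 1 * qminus N q 2 2) =
  2 * qminus N x 3 3 ^+ 2 *
    (qminus N x 6 3 * qplus N x 3 1 * qplus N x 3 2 - q * qplus N x 3 3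
     - 2 * q ^+ 2 * qminus N x 6 1 * qminus N x 6 5 * qplus N x 3 3 ^+ 3).
Proof.
move=> q0 N0; have x0 : x ^+ N = 0 by apply: nilp_exprX.
(* [jacobi_triple] asks for more than 2 N, at length l as well as at 3 l + 1. *)
pose l := N.*2.+1; have Nl : (N.*2 < l)%N by [].
have N3l : (N.*2 < (3 * l).+1)%N by rewrite /l; lia.
(* In each dissection two pieces coincide up to exchanging the arguments; they give -2 q f(-x, -x^5)
   and 2 f(x, x^2). *)
have phi := theta_3dissection l (- q ^+ 1) (- q ^+ 1).
have psi := theta_3dissection l 1 (q ^+ 1).
have e1 : (- q ^+ 1) ^+ 6 * (- q ^+ 1) ^+ 3 = - x ^+ 3 by rewrite /x; ring.
have e2 : (- q ^+ 1) ^+ 3 * (- q ^+ 1) ^+ 6 = - x ^+ 3 by rewrite /x; ring.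
have e3 : (- q ^+ 1) ^+ 9 * (- q ^+ 1) ^+ 6 = - x ^+ 5 by rewrite /x; ring.
have e4 : (- q ^+ 1) ^+ 0 * (- q ^+ 1) ^+ 3 = - x ^+ 1 by rewrite /x; ring.
have e5 : (- q ^+ 1) ^+ 3 * (- q ^+ 1) ^+ 0 = - x ^+ 1 by rewrite /x; ring.
have e6 : (- q ^+ 1) ^+ 6 * (- q ^+ 1) ^+ 9 = - x ^+ 5 by rewrite /x; ring.
rewrite {}e1 {}e2 {}e3 {}e4 {}e5 {}e6 in phi.
have e1 : 1 ^+ 6 * (q ^+ 1) ^+ 3 = x ^+ 1 by rewrite /x; ring.
have e2 : 1 ^+ 3 * (q ^+ 1) ^+ 6 = x ^+ 2 by rewrite /x; ring.
have e3 : 1 ^+ 9 * (q ^+ 1) ^+ 6 = x ^+ 2 by rewrite /x; ring.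
have e4 : 1 ^+ 0 * (q ^+ 1) ^+ 3 = x ^+ 1 by rewrite /x; ring.
have e5 : 1 ^+ 3 * (q ^+ 1) ^+ 0 = 1 by rewrite /x; ring.
have e6 : 1 ^+ 6 * (q ^+ 1) ^+ 9 = x ^+ 3 by rewrite /x; ring.
rewrite {}e1 {}e2 {}e3 {}e4 {}e5 {}e6 in psi.
rewrite (theta_phi N) // (theta_phi N l x 3) // !(theta_minus N) // in phi.
rewrite !(theta_psi N) // !(theta_plus N) // in psi.
have odd1 : qminus N q 2 1 * qplus N q 1 1 = 1 := qplus_odd N q 1 q0 isT.
have odd3 : qminus N x 6 3 * qplus N x 3 3 = 1 := qplus_odd N x 3 x0 isT.
have f2 : qplus N q 1 1 * qminus N q 1 1 = qminus N q 2 2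
  := qplus_minus N q 1 1.
have f6 : qplus N x 3 3 * qminus N x 3 3 = qminus N x 6 6
  := qplus_minus N x 3 3.
have mod6 := qplus_qminus_mod6 N x x0.
(* The coefficient of q is phi(-x^3) psi(x^3) - 2 f(-x, -x^5) f(x, x^2). Divided by (x^3; x^3)^2,
   both products become (-x^3; x^3), by [odd3] and [mod6]. *)
have -> : q * qplus N x 3 3 =
  2 * q * (qplus N x 3 1 * qplus N x 3 2 * (qminus N x 6 1 * qminus N x 6 5)) *
    qplus N x 3 3 - q * (qminus N x 6 3 * qplus N x 3 3) * qplus N x 3 3.
  by rewrite mod6 odd3; ring.
have -> : 2 * (qminus N q 1 1 * qminus N q 2 2) =
  (qminus N q 2 1 * qminus N q 1 1) * (2 * qplus N q 1 1 ^+ 2 * qminus N q 1 1).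
  by rewrite -f2 -[LHS]mulr1 -odd1; ring.
rewrite [X in X * _ = _]phi psi -[(5 + 1)%N]/6%N -[(1 + 5)%N]/6%N.
rewrite -[(1 + 2)%N]/3%N -[(2 + 1)%N]/3%N.
by rewrite -[(2 * 3)%N]/6%N -f6; ring.
Qed.

(** A form of (x^3; x^6) / ((x; x^3) (x^2; x^3)) in which no minus sign occurs. *)
Definition qmixed N x : R :=
  \prod_(k < N) (geom N (x ^+ (3 * k + 2)) +
                 x ^+ (3 * k + 1) * geom N (x ^+ (3 * k + 1))).

(* As 6k + 3 = (3k + 1) + (3k + 2), this is
   (1 - uv) / ((1 - u) (1 - v)) = 1 / (1 - v) + u / (1 - u) factor by factor. *)
Lemma qmixedE N x : x ^+ N = 0 ->
  qminus N x 6 3 * (qinv N x 3 1 * qinv N x 3 2) = qmixed N x.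
Proof.
move=> x0; rewrite -!big_split; apply: eq_bigr => k _ /=.
have -> : (6 * k + 3 = (3 * k + 1) + (3 * k + 2))%N by lia.
have V r : (0 < r)%N -> (1 - x ^+ (3 * k + r)) * geom N (x ^+ (3 * k + r)) = 1.
  by move=> r0; rewrite geomE // nilp_exprX // addn_gt0 r0 orbT.
have := V 1%N isT; have := V 2 isT; rewrite [x ^+ (_ + (_ + _))]exprD.
move: (x ^+ (3 * k + 1)) (x ^+ (3 * k + 2)) => u v Vv Vu.
have -> : (1 - u * v) * (geom N u * geom N v) =
  ((1 - u) * geom N u) * geom N v + u * geom N u * ((1 - v) * geom N v) by ring.
by rewrite Vv Vu; ring.
Qed.

(** (x; x^6) / (x; x^3) = 1 / (x^4; x^6) and (x^5; x^6) / (x^2; x^3) = 1 / (x^2; x^6). *)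
Lemma qinv_mod6 N x : x ^+ N = 0 ->
  qminus N x 6 1 * qminus N x 6 5 * (qinv N x 3 1 * qinv N x 3 2) =
  qinv N x 6 2 * qinv N x 6 4.
Proof.
move=> x0.
have V2 := qminusV N x 6 2 x0 isT; have V4 := qminusV N x 6 4 x0 isT.
have W1 := qminusV N x 3 1 x0 isT; have W2 := qminusV N x 3 2 x0 isT.
have V : qminus N x 6 2 * qminus N x 6 4 *
         (qinv N x 6 2 * qinv N x 6 4) = 1 by rewrite mulrACA V2 V4 mulr1.
apply: (mul_unit_inj _ _ _ _ V); rewrite V.
have e1 : qminus N x 3 1 = qminus N x 6 1 * qminus N x 6 4.
  rewrite (qminus_split N x 2 3 1 x0) //.
  by rewrite !big_ord_recr big_ord0 /= mul1r.
have e2 : qminus N x 3 2 = qminus N x 6 2 * qminus N x 6 5.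
  rewrite (qminus_split N x 2 3 2 x0) //.
  by rewrite !big_ord_recr big_ord0 /= mul1r.
by rewrite -[RHS]mulr1 -{1}W1 -W2 e1 e2; ring.
Qed.

(** P0, P1 and P2; the last factor is set apart because it contains the 1 / (1 - x) used for strict
    positivity. *)
Definition part0 N x : R :=
  qmixed N x * qplus N x 3 1 * qplus N x 3 2 * (qinv N x 3 1 * qinv N x 3 2).
Definition part1 N x : R :=
  qplus N x 3 3 * qinv N x 3 1 * qinv N x 3 2 * (qinv N x 3 1 * qinv N x 3 2).
Definition part2 N x : R :=
  qplus N x 3 3 ^+ 3 * (qinv N x 6 2 * qinv N x 6 4) *
  (qinv N x 3 1 * qinv N x 3 2).

(** [A] stands for f_1 f_2 / f_3^2. After (x^3; x^3)^2 cancels, two copies of 1 / ((x; x^3) (x^2;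
    x^3)) remain: one absorbs the factors 1 - x^m in P0 and P2, the other is kept. *)
Lemma quotient_dissection N q A (x := q ^+ 3) : q ^+ N = 0 -> (0 < N)%N ->
  A * qminus N q 3 3 ^+ 2 = qminus N q 1 1 * qminus N q 2 2 ->
  2 * A = 2 * (part0 N x - q * part1 N x - 2 * q ^+ 2 * part2 N x).
Proof.
move=> q0 N0 eA; have x0 : x ^+ N = 0 by apply: nilp_exprX.
have := f1_f2_dissection N q q0 N0; rewrite -eA -/x => e.
have f3 : qminus N q 3 3 = qminus N x 3 1 * qminus N x 3 2 * qminus N x 3 3.
  transitivity (qminus N x 1 1).
    by apply: eq_bigr => k _; rewrite -exprM; congr (1 - q ^+ _); lia.
  rewrite (qminus_split N x 3 1 1 x0) //.
  by rewrite !big_ord_recr big_ord0 /= mul1r.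
have W1 := qminusV N x 3 1 x0 isT; have W2 := qminusV N x 3 2 x0 isT.
have W3 := qminusV N x 3 3 x0 isT.
have W : qminus N q 3 3 ^+ 2 *
         (qinv N x 3 1 * qinv N x 3 2 * qinv N x 3 3) ^+ 2 = 1.
  rewrite -exprMn f3 (_ : _ * _ = 1) ?expr1n //.
  by rewrite mulrACA W3 mulr1 mulrACA W1 W2 mulr1.
apply: (mul_unit_inj _ _ _ _ W).
rewrite [LHS]mulrCA [X in 2 * X = _]mulrC e f3 /part0 /part1 /part2.
rewrite -qmixedE // -qinv_mod6 //.
transitivity (2 * qminus N x 3 3 ^+ 2 *
  ((qminus N x 3 1 * qinv N x 3 1) * (qminus N x 3 2 * qinv N x 3 2)) ^+ 2 *
    (qminus N x 6 3 * qplus N x 3 1 * qplus N x 3 2 - q * qplus N x 3 3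
     - 2 * q ^+ 2 * qminus N x 6 1 * qminus N x 6 5 * qplus N x 3 3 ^+ 3)).
  by rewrite W1 W2; ring.
by ring.
Qed.
End Dissection.

(** * Compatibility of the products with ring morphisms *)

Section Morphism.
Context {R S : comNzRingType} (f : {rmorphism R -> S}).

Lemma rmorph_geom N x : f (geom N x) = geom N (f x).
Proof. by rewrite rmorph_sum; apply: eq_bigr => i _; rewrite rmorphXn. Qed.

Lemma rmorph_qminus N x c r : f (qminus N x c r) = qminus N (f x) c r.
Proof.
by rewrite rmorph_prod; apply: eq_bigr => k _; rewrite rmorphB rmorph1 rmorphXn.
Qed.

Lemma rmorph_qplus N x c r : f (qplus N x c r) = qplus N (f x) c r.
Proof.
by rewrite rmorph_prod; apply: eq_bigr => k _; rewrite rmorphD rmorph1 rmorphXn.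
Qed.

Lemma rmorph_qinv N x c r : f (qinv N x c r) = qinv N (f x) c r.
Proof.
by rewrite rmorph_prod; apply: eq_bigr => k _; rewrite rmorph_geom rmorphXn.
Qed.

Lemma rmorph_qmixed N x : f (qmixed N x) = qmixed N (f x).
Proof.
rewrite rmorph_prod; apply: eq_bigr => k _.
by rewrite rmorphD rmorphM !rmorph_geom !rmorphXn.
Qed.

Lemma rmorph_part0 N x : f (part0 N x) = part0 N (f x).
Proof. by rewrite !rmorphM rmorph_qmixed !rmorph_qplus !rmorph_qinv. Qed.

Lemma rmorph_part1 N x : f (part1 N x) = part1 N (f x).
Proof. by rewrite !rmorphM rmorph_qplus !rmorph_qinv. Qed.

Lemma rmorph_part2 N x : f (part2 N x) = part2 N (f x).
Proof. by rewrite !rmorphM rmorph_qplus !rmorph_qinv. Qed.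
End Morphism.

(** * Positivity of the coefficients of P0, P1 and P2 *)

Section Positivity.
Implicit Types (p r : {poly int}) (N n : nat).

(** Stable under products; the constant coefficient 1 is what yields strict positivity in
    [geomM_gt0]. *)
Definition nneg_unitary p := (forall i, 0 <= p`_i) /\ p`_0 = 1.

Lemma nneg_unitary1 : nneg_unitary 1.
Proof. by split=> [i|]; rewrite coef1 ?ler0n. Qed.

Lemma coefM_ge0 p r i :
  (forall i, 0 <= p`_i) -> (forall i, 0 <= r`_i) -> 0 <= (p * r)`_i.
Proof. by move=> p0 r0; rewrite coefM sumr_ge0 // => j _; rewrite mulr_ge0. Qed.

Lemma nneg_unitaryM p r :
  nneg_unitary p -> nneg_unitary r -> nneg_unitary (p * r).
Proof.
case=> p0 p1 [r0 r1]; split=> [i|]; first exact: coefM_ge0.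
by rewrite coef0M p1 r1 mulr1.
Qed.

Lemma nneg_unitary_prod N (F : nat -> {poly int}) :
  (forall k, nneg_unitary (F k)) -> nneg_unitary (\prod_(k < N) F k).
Proof.
move=> F1; elim/big_ind: _ => //; [exact: nneg_unitary1|exact: nneg_unitaryM].
Qed.

Lemma nneg_unitaryDM p r d :
  nneg_unitary p -> nneg_unitary r -> nneg_unitary (p + 'X^(d.+1) * r).
Proof.
case=> p0 p1 [r0 _]; split=> [i|]; rewrite coefD coefXnM; last first.
  by rewrite p1 addr0.
by case: ifP => _; rewrite ?addr0 ?addr_ge0.
Qed.

Lemma nneg_unitary_geom N d : (0 < N)%N -> nneg_unitary (geom N 'X^(d.+1)).
Proof.
case: N => // N _; split=> [i|].
  by rewrite coef_sum sumr_ge0 // => j _; rewrite -exprM coefXn ler0n.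
rewrite /geom big_ord_recl expr0 coefD coef1 coef_sum big1 ?addr0 // => i _.
by rewrite -exprM coefXn lift0 mulnS.
Qed.

Lemma nneg_unitary_qplus N c s : nneg_unitary (qplus N 'X c s.+1).
Proof.
apply: (nneg_unitary_prod N (fun k => 1 + 'X^(c * k + s.+1))) => k.
by rewrite addnS -['X^_]mulr1; apply: nneg_unitaryDM; exact: nneg_unitary1.
Qed.

Lemma nneg_unitary_qinv N c s : (0 < N)%N -> nneg_unitary (qinv N 'X c s.+1).
Proof.
move=> N0.
apply: (nneg_unitary_prod N (fun k => geom N 'X^(c * k + s.+1))) => k.
by rewrite addnS; exact: nneg_unitary_geom.
Qed.

Lemma nneg_unitary_qmixed N : (0 < N)%N -> nneg_unitary (qmixed N 'X).
Proof.
move=> N0; apply: (nneg_unitary_prod N (fun k => geom N 'X^(3 * k + 2) +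
  'X^(3 * k + 1) * geom N 'X^(3 * k + 1))) => k.
by rewrite addn1 addn2; apply: nneg_unitaryDM; exact: nneg_unitary_geom.
Qed.

(** For n < N the coefficient is p_0 + ... + p_n, with p_0 = 1. *)
Lemma geomM_gt0 N p n : nneg_unitary p -> (n < N)%N -> 0 < (geom N 'X * p)`_n.
Proof.
case=> p0 p1 nN.
have -> : geom N 'X = \poly_(i < N) 1 :> {poly int}.
  by rewrite poly_def; apply: eq_bigr => i _; rewrite scale1r.
rewrite coefM big_ord_recr /= subnn p1 coef_poly nN ltr_wpDl //.
by apply: sumr_ge0 => i _; rewrite coef_poly; case: ifP => _;
  rewrite ?mul0r ?mul1r.
Qed.

Lemma qinv_geomM_gt0 N p n : nneg_unitary p -> (n < N)%N ->
  0 < (p * (qinv N 'X 3 1 * qinv N 'X 3 2))`_n.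
Proof.
move=> p1 nN; have N0 : (0 < N)%N by apply: leq_ltn_trans nN.
suff [r r1 ->] : exists2 r, nneg_unitary r & qinv N 'X 3 1 = geom N 'X * r.
  rewrite mulrCA -mulrA; apply: geomM_gt0 => //.
  by do ! apply: nneg_unitaryM => //; exact: nneg_unitary_qinv.
case: N N0 {nN} => // N _; rewrite /qinv big_ord_recl muln0 add0n expr1.
eexists; last by reflexivity.
apply: (nneg_unitary_prod N (fun k => geom N.+1 'X^(3 * k.+1 + 1))) => k.
by rewrite addn1; exact: nneg_unitary_geom.
Qed.

Lemma part0_gt0 N n : (n < N)%N -> 0 < (part0 N 'X : {poly int})`_n.
Proof.
move=> nN; have N0 : (0 < N)%N by apply: leq_ltn_trans nN.
apply: qinv_geomM_gt0 => //; do ! apply: nneg_unitaryM;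
  by [exact: nneg_unitary_qmixed | exact: nneg_unitary_qplus].
Qed.

Lemma part1_gt0 N n : (n < N)%N -> 0 < (part1 N 'X : {poly int})`_n.
Proof.
move=> nN; have N0 : (0 < N)%N by apply: leq_ltn_trans nN.
apply: qinv_geomM_gt0 => //; do ! apply: nneg_unitaryM;
  by [exact: nneg_unitary_qinv | exact: nneg_unitary_qplus].
Qed.

Lemma part2_gt0 N n : (n < N)%N -> 0 < (part2 N 'X : {poly int})`_n.
Proof.
move=> nN; have N0 : (0 < N)%N by apply: leq_ltn_trans nN.
rewrite /part2 !exprS expr0 mulr1.
apply: qinv_geomM_gt0 => //; do ! apply: nneg_unitaryM;
  by [exact: nneg_unitary_qinv | exact: nneg_unitary_qplus].
Qed.
End Positivity.

(** * Power series reduced to Z[X] / (X^N) *)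

Section Truncation.
Context (N : nat) (N1 : (1 < N)%N).
Local Notation qring := {poly %/ ('X^N : {poly int})}.
Local Notation toq := (in_qpoly ('X^N : {poly int})).
Implicit Types (p r : {poly int}) (a b : fps).

Lemma mk_monicXn : mk_monic ('X^N : {poly int}) = 'X^N.
Proof. by rewrite mk_monic_Xn prednK // ltnW. Qed.

Lemma coef_toq p i : (i < N)%N -> (toq p : {poly int})`_i = p`_i.
Proof.
move=> iN; have mX : ('X^N : {poly int}) \is monic by exact: monicXn.
rewrite /= mk_monicXn [in RHS](Pdiv.RingMonic.rdivp_eq mX p).
by rewrite coefD coefMXn iN add0r.
Qed.

Lemma toq_eqP p r : (forall i, (i < N)%N -> p`_i = r`_i) <-> toq p = toq r.
Proof.
split=> [e|e i iN]; last by rewrite -[p`_i]coef_toq // e coef_toq.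
apply/val_inj/polyP => i; have [iN|Ni] := ltnP i N.
  by rewrite !coef_toq // e.
have small (s : qring) : (s : {poly int})`_i = 0.
  rewrite nth_default // (leq_trans _ Ni) //.
  have sz : size (mk_monic ('X^N : {poly int})) = N.+1.
    by rewrite mk_monicXn size_polyXn.
  by rewrite -ltnS -sz; exact: size_mk_monic.
by rewrite [LHS]small [RHS]small.
Qed.

Definition fps_toq a : qring := toq (\poly_(i < N) a i).

Lemma fps_toqE a p : (forall i, (i < N)%N -> a i = p`_i) -> fps_toq a = toq p.
Proof. by move=> e; apply/toq_eqP => i iN; rewrite coef_poly iN e. Qed.

Lemma fps_toqM a b : fps_toq (fps_mul a b) = fps_toq a * fps_toq b.
Proof.
rewrite -in_qpolyM; apply: fps_toqE => i iN; rewrite coefM.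
apply: eq_bigr => j _; rewrite !coef_poly.
by have ji := ltn_ord j; rewrite !ifT //; lia.
Qed.

Lemma toqXN : (toq 'X) ^+ N = 0.
Proof.
rewrite -rmorphXn -(rmorph0 toq); apply/toq_eqP => i iN.
by rewrite coefXn coef0 ltn_eqF.
Qed.

Lemma fps_toq_eulerf j : (0 < j)%N ->
  fps_toq (eulerf j) = qminus N (toq 'X) j j.
Proof.
move=> j0; rewrite -rmorph_qminus; apply: fps_toqE => i iN.
rewrite (eulerfE j0 (ltnW iN)) big_add1 big_mkord /qminus.
by under [in RHS]eq_bigr do rewrite -mulnSr.
Qed.

Lemma fps_toqV b : b 0%N = 1 -> fps_toq (fps_inv b) * fps_toq b = 1.
Proof.
move=> b0; rewrite -fps_toqM -(rmorph1 toq); apply: fps_toqE => i _.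
by rewrite fps_mulVr // coef1.
Qed.

Lemma a_1_2_3m2_dissection n : (n < N)%N ->
  a_1_2_3m2 n = (part0 N 'X \Po 'X^3 - 'X * (part1 N 'X \Po 'X^3)
                 - 2 * 'X^2 * (part2 N 'X \Po 'X^3) : {poly int})`_n.
Proof.
move=> nN; set T := (X in _ = (polyseq X)`_n).
set a := \poly_(i < N) a_1_2_3m2 i.
(* The factor 2 is cancelled on coefficients, in [int]. *)
suff /toq_eqP/(_ n nN) : toq (2 * a) = toq (2 * T).
  rewrite !(mulr_natl _ 2) !coefMn coef_poly nN => /eqP.
  by rewrite eqrMn2r => /eqP.
have N0 := ltnW N1.
have := quotient_dissection N (toq 'X) (fps_toq a_1_2_3m2) toqXN N0.
have toqE A B C : toq (2 * (A - 'X * B - 2 * 'X^2 * C)) =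
    2 * (toq A - toq 'X * toq B - 2 * toq 'X ^+ 2 * toq C).
  by rewrite !(rmorphM, rmorphB, rmorph_nat).
(* Both the substitution of ['X^3] and the reduction modulo X^N are ring morphisms, so they pass
   inside the products. *)
rewrite /T (rmorph_part0 (comp_poly 'X^3)) (rmorph_part1 (comp_poly 'X^3)).
rewrite (rmorph_part2 (comp_poly 'X^3)) /= comp_polyX toqE.
rewrite (rmorph_part0 toq) (rmorph_part1 toq) (rmorph_part2 toq) rmorphXn.
rewrite rmorphM rmorph_nat => -> //.
rewrite expr2 -!fps_toq_eulerf // -[fps_toq (eulerf 3) * _]fps_toqM.
rewrite -[fps_toq (eulerf 1) * _]fps_toqM /a_1_2_3m2 /fps_div.
rewrite (fps_toqM (fps_mul _ _) (fps_inv _)) -mulrA fps_toqV ?mulr1 //.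
exact: eulerf_sqr0.
Qed.
End Truncation.

(** * Coefficients by exponent modulo 3, and their signs *)

Lemma coef_dissection (A B C : {poly int}) n
    (T := A \Po 'X^3 - 'X * (B \Po 'X^3) - 2 * 'X^2 * (C \Po 'X^3)) :
  [/\ T`_(3 * n) = A`_n, T`_(3 * n + 1) = - B`_n
    & T`_(3 * n + 2) = - (C`_n *+ 2)].
Proof.
split; rewrite /T !coefB -mulrA mulr_natl coefMn coefXM coefXnM;
  rewrite !coef_comp_poly_Xn //;
  repeat (case: ifP => ?; try by exfalso; lia);
  rewrite ?mul0rn ?subr0 ?sub0r; do ? congr (- _); do ? congr (_ *+ 2);
  by congr (_`_ _); lia.
Qed.

Theorem theorem3p3 (n : nat) :
  [/\ 0 < a_1_2_3m2 (3 * n)%N,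
      a_1_2_3m2 (3 * n + 1)%N < 0
    & a_1_2_3m2 (3 * n + 2)%N < 0].
Proof.
(* The precision 3 n + 3 exceeds the three exponents considered, and n. *)
have N1 : (1 < 3 * n + 3)%N by rewrite addnS ltnS addnS.
have nN : (n < 3 * n + 3)%N by lia.
have c0 := part0_gt0 _ _ nN; have c1 := part1_gt0 _ _ nN.
have c2 := part2_gt0 _ _ nN.
have [d0 d1 d2] := coef_dissection (part0 (3 * n + 3) 'X)
  (part1 (3 * n + 3) 'X) (part2 (3 * n + 3) 'X) n.
split; rewrite (a_1_2_3m2_dissection _ N1); try lia.
- by rewrite d0.
- by rewrite d1 oppr_lt0.
- by rewrite d2 oppr_lt0 pmulrn_lgt0.
Qed.
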